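(* (1) Let $n\ge1$. Every strongly reversible element $f$ of $G_n$ whose associated permutation $\sigma_f$ is an $n$-cycle (or, more generally, is a product of disjoint cycles of pairwise distinct lengths, fixed points being counted as cycles of length 1) has finite order. There exist finite order elements of $G_n$ that are not strongly reversible in $G_n$. (2) There exist $n$ and a strongly reversible element of $G_n$ that is not of finite order. However, for every $n$, no element of $G_n$ is both minimal and strongly reversible in $G_n$.
   Context: An interval exchange transformation (IET) is a bijection of $[0,1)$ defined by a finite partition of $[0,1)$ into half-open subintervals and a reordering of these intervals by translations. Let $\mathcal S_n$ be the group of permutations of $\{1,\dots,n\}$, $\mathbb S_n=[0,\frac1n]/(0=\frac1n)\cong\mathbb R/\frac1n\mathbb Z$, and $I_i=[\frac{i-1}{n},\frac in)$. $G_n$ is the group of IETs $g$ for which there are $\sigma_g\in\mathcal S_n$ (the associated permutation) and $\alpha_g=(\alpha_1(g),\dots,\alpha_n(g))\in\mathbb S_n^n$ such that $g$ maps $I_i$ onto $I_{\sigma_g(i)}$ by translating $I_i$ to $I_{\sigma_g(i)}$ and then rotating by $\alpha_i(g)$ (mod $\frac1n$ inside $I_{\sigma_g(i)}$). An element $f$ of a group $G$ is strongly reversible in $G$ if there is $b\in G$ with $b^2=1$ and $bfb=f^{-1}$. An IET is minimal if all its orbits are dense in $[0,1)$. *)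

(* Defs.v *)
From HB Require Import structures.
From mathcomp Require Import all_boot all_order all_fingroup all_algebra.
From mathcomp Require Import all_classical all_reals all_analysis.

Set Implicit Arguments.
Unset Strict Implicit.
Unset Printing Implicit Defensive.

Import Order.TTheory GRing.Theory Num.Theory.
Import numFieldNormedType.Exports.

Local Open Scope classical_set_scope.
Local Open Scope ring_scope.

(* The group of all bijections of a type; the product is [f * g = f \o g]. *)
Record selfbij (T : Type) := SelfBij {
  sb_fun :> T -> T;
  sb_inv : T -> T;
  sb_funK : cancel sb_fun sb_inv;
  sb_invK : cancel sb_inv sb_fun
}.

Lemma selfbijP (T : Type) (f g : selfbij T) : f =1 g -> f = g.
Proof.
case: f g => [f f' fK f'K] [g g' gK g'K] /= /funext fg.
subst g; have fg' : f' = g' by apply/funext => x; rewrite -[x in LHS]g'K fK.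
by subst g'; congr SelfBij; apply: Prop_irrelevance.
Qed.

HB.instance Definition _ (T : Type) := gen_eqMixin (selfbij T).
HB.instance Definition _ (T : Type) := gen_choiceMixin (selfbij T).

Section SelfBijGroup.
Variable T : Type.
Implicit Types f g h : selfbij T.

Definition sb_one : selfbij T := @SelfBij T id id (frefl _) (frefl _).
Definition sb_opp f : selfbij T := SelfBij (sb_invK f) (sb_funK f).
Definition sb_mul f g : selfbij T :=
  SelfBij (can_comp (sb_funK f) (sb_funK g)) (can_comp (sb_invK g) (sb_invK f)).

Fact sb_mulA : associative sb_mul. Proof. by move=> f g h; exact: selfbijP. Qed.
Fact sb_mul1g : left_id sb_one sb_mul. Proof. by move=> f; exact: selfbijP. Qed.
Fact sb_mulg1 : right_id sb_one sb_mul. Proof. by move=> f; exact: selfbijP. Qed.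
Fact sb_mulVg : left_inverse sb_one sb_opp sb_mul.
Proof. by move=> f; apply: selfbijP => x /=; rewrite sb_funK. Qed.
Fact sb_mulgV : right_inverse sb_one sb_opp sb_mul.
Proof. by move=> f; apply: selfbijP => x /=; rewrite sb_invK. Qed.

HB.instance Definition _ := isGroup.Build (selfbij T)
  sb_mulA sb_mul1g sb_mulg1 sb_mulVg sb_mulgV.

End SelfBijGroup.

Section GroupNotions.
Variable gT : groupType.

Definition finite_order (f : gT) : Prop :=
  exists2 k : nat, (0 < k)%N & (f ^+ k = 1)%g.

Definition strongly_reversible_in (G : set gT) (f : gT) : Prop :=
  G f /\ exists b : gT, [/\ G b, (b ^+ 2 = 1)%g & (b * f * b = f^-1)%g].

End GroupNotions.

Definition unit_itv (R : realType) : Type := {x : R | x \in `[0, 1[ }.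

Section IET.
Variable R : realType.
Implicit Types g : selfbij (unit_itv R).

(* The cut points are [0 :: s], with [s] strictly increasing from above [0] up
   to [1]. As [g] is a bijection, the translated pieces again partition the unit
   interval, i.e. [g] rearranges them. *)
Definition is_iet g : Prop :=
  exists (s : seq R) (d : nat -> R), itv_partition 0 1 s /\
    forall (i : nat) (x : unit_itv R), (i < size s)%N ->
      nth 0 (0 :: s) i <= \val x < nth 0 s i -> \val (g x) = \val x + d i.

(* Two-sided orbit, as a subset of the line. *)
Definition orbit_of g (x : unit_itv R) : set R :=
  [set y | exists k : nat, y = \val ((g ^+ k)%g x) \/ y = \val ((g ^- k)%g x)].

Definition minimal g : Prop :=
  forall x : unit_itv R, `[0, 1[ `<=` closure (orbit_of g x).

(* [y |-> y + a], modulo [n^-1], inside [j/n, (j+1)/n[, for [0 <= a < n^-1]. *)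
Definition rotate (n : nat) (j : 'I_n) (a y : R) : R :=
  if y + a < j.+1%:R / n%:R then y + a else y + a - n%:R^-1.

(* Indices start at 0, so that the i-th interval is [i/n, (i+1)/n[. The circle
   of length [n^-1] is represented by [0, n^-1[. For [n > 0], [s] and [a] are
   determined by [g]. *)
Definition has_rotation_data (n : nat) g (s : 'S_n) (a : 'I_n -> R) : Prop :=
  (forall i, 0 <= a i < n%:R^-1) /\
  forall (i : 'I_n) (x : unit_itv R),
    i%:R / n%:R <= \val x < i.+1%:R / n%:R ->
    \val (g x) = rotate (s i) (a i) (\val x + ((s i)%:R - i%:R) / n%:R).

Definition associated_perm (n : nat) g (s : 'S_n) : Prop :=
  exists a : 'I_n -> R, has_rotation_data g s a.

Definition Gn (n : nat) : set (selfbij (unit_itv R)) :=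
  [set g | is_iet g /\ exists s : 'S_n, associated_perm g s].

End IET.

Arguments Gn R n : clear implicits.

Definition is_full_cycle (n : nat) (s : 'S_n) : Prop :=
  porbits s = [set [set: 'I_n]%SET]%SET.

(* [porbits s] includes the singleton orbits of the fixed points. *)
Definition distinct_cycle_lengths (n : nat) (s : 'S_n) : Prop :=
  {in porbits s &, injective (fun C : {set 'I_n} => #|C|)}.

(* Main.v *)
(* Identify [0,1[ with n disjoint circles R/Z, so that an element of G_n permutes
   the circles by s and rotates circle i by a_i. If b is an involution reversing
   f, its permutation conjugates s to s^-1, hence maps each cycle of s to a cycle
   of the same length; when these lengths are distinct it preserves every cycle.
   For N the order of s, f^N rotates circle i by an amount A_i depending only on
   the cycle of i, and conjugating by b turns A_i into -A_i. So 2 A_i = 0 and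
   f^(2N) = 1. A minimal f has s transitive, hence falls under this case, and a
   map of finite order is not minimal. The rotation of all circles by 1/3 is
   central of order 3, so it is not reversible; on two circles, the rotations by
   an irrational angle and its opposite are exchanged by the swap. *)

Require Import Defs.
From mathcomp Require Import all_boot all_order all_fingroup all_algebra.
From mathcomp Require Import all_classical all_reals all_analysis.
From mathcomp Require Import ring lra.

Set Implicit Arguments.
Unset Strict Implicit.
Unset Printing Implicit Defensive.

Import Order.TTheory GRing.Theory Num.Theory.
Import numFieldNormedType.Exports.

Local Open Scope classical_set_scope.
Local Open Scope ring_scope.

(** * Reversing elements in groups, and cycles of reversed permutations *)

(** Rid of inverses, the relation can be evaluated by composing rotation angles only. *)
Lemma reversible_eq1 (gT : groupType) (b f : gT) :
  (b * f * b = f^-1)%g -> (f * (b * (f * b)) = 1)%g.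
Proof. by rewrite -!mulgA => ->; rewrite mulgV. Qed.

Lemma reversibleX (gT : groupType) (b f : gT) k : (b ^+ 2 = 1)%g ->
  (b * f * b = f^-1)%g -> (b * f ^+ k * b = (f ^+ k)^-1)%g.
Proof.
move=> /[dup] b2; rewrite expg2 => bb bfb; elim: k => [|k IHk].
  by rewrite !expg0 mulg1 invg1.
by rewrite [in RHS]expgS invMg -IHk -bfb !mulgA -(mulgA _ b b) bb mulg1 expgSr !mulgA.
Qed.

(** Conjugation by [r] carries cycles of [s] to cycles of [s^-1], and these have the same supports
    as the cycles of [s]. *)
Lemma porbit_reversed (T : finType) (r s : {perm T}) (x : T) :
  (s ^ r)%g = (s^-1)%g -> porbit s (r x) = r @: porbit s x.
Proof.
move=> sr; have s_r : s = (s^-1 ^ r)%g by rewrite conjVg sr invgK.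
apply/setP => y; apply/porbitP/imsetP => [[k ->]|[z]].
  exists ((s^-1 ^+ k)%g x); first by rewrite -porbitV mem_porbit.
  by rewrite [in LHS]s_r -conjXg permJ.
rewrite -porbitV => /porbitP[k ->] ->; exists k.
by rewrite [in RHS]s_r -conjXg permJ.
Qed.

Lemma full_cycle_distinct (n : nat) (s : 'S_n) : is_full_cycle s -> distinct_cycle_lengths s.
Proof. by move=> sE A B; rewrite sE !inE => /eqP-> /eqP->. Qed.

(** * Fractional parts, as coordinates on the circle R/Z *)

Section FractionalPart.
Variable R : realType.
Implicit Types t u : R.

Definition frac t : R := t - (Num.floor t)%:~R.

Lemma frac_ge0 t : 0 <= frac t.
Proof. by rewrite subr_ge0 floor_le. Qed.

Lemma frac_lt1 t : frac t < 1.
Proof. by rewrite ltrBlDl -intrD1 floorD1_gt. Qed.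

Lemma frac_small t : 0 <= t < 1 -> frac t = t.
Proof. by move=> ht; rewrite /frac (@floor_def _ _ 0) ?subr0. Qed.

Lemma eq_frac t u : t - u \is a Num.int -> frac t = frac u.
Proof.
move=> htu; have -> : t = u + (t - u) by ring.
by rewrite /frac floorDrz // intrD [X in _ - (_ + X)]floorK //; ring.
Qed.

Lemma frac_inj t u : frac t = frac u -> t - u \is a Num.int.
Proof.
rewrite /frac => e.
have -> : t - u = (Num.floor t - Num.floor u)%:~R by rewrite intrB; lra.
exact: intr_int.
Qed.

Lemma sub_frac_int t : t - frac t \is a Num.int.
Proof. by rewrite /frac opprB addrC subrK intr_int. Qed.

(** The carry on the right has the same shape as the wrap-around test in [rotate]. *)
Lemma fracD t u :
  frac (t + u) = if frac t + frac u < 1 then frac t + frac u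
                 else frac t + frac u - 1.
Proof.
have [t0 t1] := (frac_ge0 t, frac_lt1 t); have [u0 u1] := (frac_ge0 u, frac_lt1 u).
have tu : t + u - (frac t + frac u) \is a Num.int.
  by rewrite opprD addrACA rpredD ?sub_frac_int.
case: ltP => h; (rewrite -[RHS]frac_small; last by lra).
  exact: eq_frac.
by apply: eq_frac; rewrite opprB addrC -addrA (addrC (- _)) rpredD ?rpred1.
Qed.

End FractionalPart.

(** * A criterion for interval exchanges; minimality against finite order *)

(** Spares later proofs any sorting: [cuts] may be unordered, repeat points, or leave the unit
    interval. The partition consists of the sorted cuts inside ]0,1[, followed by 1. *)
Lemma cut_points_is_iet (R : realType) (g : selfbij (unit_itv R)) (cuts : seq R) :
  (forall x y : unit_itv R, \val x <= \val y ->
     (forall p, p \in cuts -> ~~ (\val x < p <= \val y)) ->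
     \val (g y) - \val y = \val (g x) - \val x) ->
  is_iet g.
Proof.
move=> hg; pose t := sort <=%R (undup [seq p <- cuts | 0 < p < 1]).
have mem_t p : p \in t = (0 < p < 1) && (p \in cuts).
  by rewrite mem_sort mem_undup mem_filter.
pose s := rcons t 1.
have s_path : path <%R 0 s.
  rewrite rcons_path path_sortedE; last exact: lt_trans.
  rewrite sort_lt_sorted undup_uniq andbT; apply/andP; split.
    by apply/allP => p; rewrite mem_t => /andP[/andP[]].
  by have := mem_last 0 t; rewrite inE mem_t => /orP[/eqP->|/andP[/andP[]]].
(* Each piece moves as its left endpoint does; the default 0 only serves indices whose point lies
   outside [0,1[. *)
exists s, (fun i => if insub (nth 0 (0 :: s) i) is Some x
                    then \val (g x) - \val x else 0).
split; first by split => //; rewrite last_rcons.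
move=> i y i_lt /andP[yi yi1].
have sorted0 : sorted <%R (0 :: s) by [].
have mono := lt_sorted_ltn_nth 0 sorted0.
have := valP y; rewrite in_itv /= => /andP[y0 y1].
have xP : nth 0 (0 :: s) i \in `[0, 1[.
  rewrite in_itv /= (le_lt_trans yi y1) andbT.
  have : nth 0 (0 :: s) i \in 0 :: s by rewrite mem_nth //= ltnW.
  rewrite inE => /orP[/eqP->//|].
  rewrite mem_rcons inE mem_t => /orP[/eqP->|/andP[/andP[/ltW]]] //.
case: insubP => [x _ xE|/negP//]; rewrite -xE in yi xP.
apply/eqP; rewrite addrC -subr_eq; apply/eqP; apply: (hg x y) => // p pc.
apply/negP; rewrite xE => /andP[xp py].
have p01 : 0 < p < 1.
  by rewrite (le_lt_trans py y1) andbT; move: xP; rewrite in_itv xE => /andP[/le_lt_trans ->].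
have ps : p \in 0 :: s by rewrite inE mem_rcons inE mem_t p01 pc !orbT.
have k_lt : (index p (0%R :: s) < (size s).+1)%N.
  by rewrite -[(size s).+1]/(size (0%R :: s)) index_mem.
(* A cut separating [x] from [y] would have an index strictly between [i] and [i.+1]. *)
have := mono i (index p (0 :: s)).
rewrite nth_index // xp !inE /= => /(_ (ltnW i_lt) k_lt).
have := mono (index p (0 :: s)) i.+1; rewrite nth_index //= !inE => /(_ k_lt i_lt).
by rewrite (le_lt_trans py yi1) => /esym h1 /esym h2; move: h1; rewrite ltnS leqNgt h2.
Qed.

(** Orbits are finite, hence closed; a dense one would contain [0,1[, which has Lebesgue measure 1
    and so is not countable. *)
Lemma finite_order_not_minimal (R : realType) (f : selfbij (unit_itv R)) :
  finite_order f -> ~ minimal f.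
Proof.
move=> [k k_gt0 fk] f_min.
have x : unit_itv R by exists 0; rewrite in_itv /= lexx ltr01.
(* Since [f^-1] equals [f ^+ k.-1], backward orbits add no points. *)
have fV l : exists q, (f ^- l = f ^+ q)%g.
  exists (l * k.-1)%N; rewrite mulnC expgM -expVgn; congr (_ ^+ l)%g.
  by apply: (mulgI f); rewrite mulgV -expgS prednK.
have fin_orbit : finite_set (orbit_of f x).
  apply: (@sub_finite_set _ _ ((fun l => \val ((f ^+ l)%g x)) @` `I_k)).
    have red q : ((fun l => \val ((f ^+ l)%g x)) @` `I_k) (\val ((f ^+ q)%g x)).
      exists (q %% k)%N; first by rewrite /= ltn_mod.
      by rewrite [in RHS](divn_eq q k) expgD mulnC expgM fk expg1n mul1g.
    by move=> _ [l [|] ->] //; have [q ->] := fV l.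
  exact: finite_image.
have : `[0, 1[ `<=` orbit_of f x.
  have /closure_id -> : closed (orbit_of f x); last exact: f_min.
  apply: accessible_finite_set_closed.1 => //.
  exact/hausdorff_accessible/Rhausdorff.
move=> /sub_finite_set /(_ fin_orbit) /finite_set_countable.
move=> /countable_lebesgue_measure0; rewrite lebesgue_measure_itv /= lte_fin ltr01.
by rewrite oppr0 adde0 => /eqP; rewrite eqe oner_eq0.
Qed.

(** * The unit interval as a disjoint union of n circles *)

Section Circles.
Variables (R : realType) (m : nat).
Local Notation n := m.+1.
Local Notation U := (unit_itv R).
Implicit Types (i j : 'I_n) (t u : R) (x y : U) (g h : selfbij U) (s : 'S_n)
  (a c : 'I_n -> R).

Let n_gt0 : 0 < n%:R :> R. Proof. by rewrite ltr0n. Qed.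
Let n_neq0 : n%:R != 0 :> R. Proof. exact: lt0r_neq0. Qed.

Fact circle_pt_subproof i t : (i%:R + frac t) / n%:R \in `[0, 1[%R.
Proof.
have f0 := frac_ge0 t; have f1 := frac_lt1 t; have i0 := ler0n R i.
rewrite in_itv /= ltr_pdivrMr // mul1r divr_ge0 ?(addr_ge0 i0 f0) ?ler0n //=.
have : i%:R + 1 <= n%:R :> R by rewrite natr1 ler_nat.
by lra.
Qed.

(* The circle is normalized to have length 1: [t] is read modulo the integers. *)
Definition circle_pt i t : U :=
  exist (fun x : R => x \in `[0, 1[%R) _ (circle_pt_subproof i t).

Lemma val_circle_pt i t : \val (circle_pt i t) = (i%:R + frac t) / n%:R.
Proof. by []. Qed.

Lemma eq_circle_pt i t u : t - u \is a Num.int -> circle_pt i t = circle_pt i u.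
Proof. by move=> htu; apply: val_inj; rewrite /= (eq_frac htu). Qed.

Lemma circle_pt_inj i j t u : circle_pt i t = circle_pt j u ->
  i = j /\ t - u \is a Num.int.
Proof.
move/(congr1 \val) => /= /(mulIf (invr_neq0 n_neq0)) e.
have [[t0 t1] [u0 u1]] := ((frac_ge0 t, frac_lt1 t), (frac_ge0 u, frac_lt1 u)).
have ij : i = j.
  apply/val_inj/eqP; rewrite eqn_leq -ltnS -[X in _ && X]ltnS.
  by rewrite -!(ltr_nat R) -!natr1; apply/andP; split; lra.
by split=> //; apply: frac_inj; move: e; rewrite ij => /addrI.
Qed.

Lemma circle_of_subproof x : (`|Num.floor (n%:R * \val x)| < n)%N.
Proof.
have := valP x; rewrite in_itv /= => /andP[x0 x1].
have f0 : 0 <= Num.floor (n%:R * \val x) by rewrite floor_ge0 mulr_ge0 ?ler0n.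
rewrite -ltz_nat gez0_abs // floor_lt_int -pmulrn.
by rewrite -[ltRHS]mulr1 ltr_pM2l.
Qed.

Definition circle_of x : 'I_n := Ordinal (circle_of_subproof x).

Lemma circle_of_natE x :
  (circle_of x)%:R = (Num.floor (n%:R * \val x))%:~R :> R.
Proof.
have := valP x; rewrite in_itv /= => /andP[x0 x1].
have f0 : 0 <= Num.floor (n%:R * \val x) by rewrite floor_ge0 mulr_ge0 ?ler0n.
by rewrite -[in RHS](gez0_abs f0).
Qed.

Lemma circle_ptK x : circle_pt (circle_of x) (n%:R * \val x) = x.
Proof.
apply: val_inj; rewrite val_circle_pt circle_of_natE /frac addrC subrK.
by rewrite mulrC mulKf.
Qed.

Lemma circle_ptP x : exists i t, x = circle_pt i t.
Proof. by exists (circle_of x), (n%:R * \val x); rewrite circle_ptK. Qed.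

Lemma circle_of_pt i t : circle_of (circle_pt i t) = i.
Proof. by have /circle_pt_inj[] := circle_ptK (circle_pt i t). Qed.

Lemma coord_of_pt i t : n%:R * \val (circle_pt i t) - t \is a Num.int.
Proof. by have /circle_pt_inj[] := circle_ptK (circle_pt i t). Qed.

Lemma circle_of_itv x i :
  i%:R / n%:R <= \val x < i.+1%:R / n%:R <-> circle_of x = i.
Proof.
rewrite ler_pdivrMr // ltr_pdivlMr // [_ * n%:R]mulrC.
split=> [/andP[h1 h2]|<-].
  apply: val_inj => /=.
  by rewrite (@floor_def _ _ i%:Z) // intrD -!pmulrn h1 natr1.
by rewrite -[X in _ < X]natr1 circle_of_natE -intrD1 floor_itv.
Qed.

(** * Elements of G_n as permutations of circles with rotation angles *)

(** Angles are counted in full turns and matter only modulo the integers; unlike in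
    [has_rotation_data] they are not normalized, so composition simply adds them. *)
Definition acts_by g s a := forall i t, g (circle_pt i t) = circle_pt (s i) (t + a i).

Lemma rotate_circle i t b : 0 <= b < 1 ->
  rotate i (b / n%:R) ((i%:R + frac t) / n%:R) = (i%:R + frac (t + b)) / n%:R :> R.
Proof.
move=> /andP[b0 b1]; have [f0 f1] := (frac_ge0 t, frac_lt1 t).
rewrite fracD (@frac_small _ b) ?b0 //.
rewrite /rotate -mulrDl -addrA ltr_pM2r ?invr_gt0 // -(natr1 i) ltrD2l.
by case: ltP => h //; field.
Qed.

Lemma rotation_data_acts_by g s a :
  has_rotation_data g s a -> acts_by g s (fun i => n%:R * a i).
Proof.
move=> [ha hg] i t; apply: val_inj.
rewrite (hg i); last by apply/circle_of_itv; exact: circle_of_pt.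
rewrite !val_circle_pt -rotate_circle; last first.
  have /andP[a0 a1] := ha i.
  by rewrite mulr_ge0 ?ler0n //= mulrC -ltr_pdivlMr // mul1r.
by congr rotate; field.
Qed.

Lemma acts_by_associated_perm g s a : acts_by g s a -> associated_perm g s.
Proof.
move=> hg; exists (fun i => frac (a i) / n%:R); split=> [i|i x /circle_of_itv xi].
  by rewrite divr_ge0 ?frac_ge0 ?ler0n //= -[ltRHS]mul1r ltr_pM2r ?invr_gt0 ?frac_lt1.
have := circle_ptK x; rewrite xi => <-; rewrite hg !val_circle_pt.
set t := n%:R * _.
have -> : (i%:R + frac t) / n%:R + ((s i)%:R - i%:R) / n%:R =
  ((s i)%:R + frac t) / n%:R by field.
rewrite rotate_circle ?frac_ge0 ?frac_lt1 //; congr (_ / _); congr (_ + _).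
by apply: eq_frac; rewrite opprD addrACA subrr add0r sub_frac_int.
Qed.

Lemma circle_iet_subproof s a :
  cancel (fun x => circle_pt (s (circle_of x)) (n%:R * \val x + a (circle_of x)))
    (fun x => circle_pt (s^-1%g (circle_of x))
       (n%:R * \val x - a (s^-1%g (circle_of x)))).
Proof.
move=> x /=; rewrite circle_of_pt permK -[RHS]circle_ptK; apply: eq_circle_pt.
by rewrite -addrA -opprD [a _ + _]addrC; exact: coord_of_pt.
Qed.

Lemma circle_iet_subproofV s a :
  cancel (fun x => circle_pt (s^-1%g (circle_of x))
       (n%:R * \val x - a (s^-1%g (circle_of x))))
    (fun x => circle_pt (s (circle_of x)) (n%:R * \val x + a (circle_of x))).
Proof.
move=> x /=; rewrite circle_of_pt permKV -[RHS]circle_ptK; apply: eq_circle_pt.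
set b := a _; have -> : forall p q : R, p + b - q = p - (q - b) by move=> *; ring.
exact: coord_of_pt.
Qed.

Definition circle_iet s a : selfbij U :=
  SelfBij (circle_iet_subproof s a) (circle_iet_subproofV s a).

Lemma circle_iet_acts_by s a : acts_by (circle_iet s a) s a.
Proof.
move=> i t /=; rewrite circle_of_pt; apply: eq_circle_pt.
by rewrite opprD addrACA subrr addr0; exact: coord_of_pt.
Qed.

Lemma acts_by_is_iet g s a : acts_by g s a -> is_iet g.
Proof.
(* The cuts are the right ends of the circles and, in circle [i], the point where adding [a i] wraps
   around. *)
move=> hg; pose C : seq R := [seq i.+1%:R / n%:R | i : 'I_n] ++
  [seq (i.+1%:R - frac (a i)) / n%:R | i : 'I_n].
have C1 i : i.+1%:R / n%:R \in C.
  by rewrite mem_cat; apply/orP; left; apply/mapP; exists i; rewrite ?mem_enum.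
have C2 i : (i.+1%:R - frac (a i)) / n%:R \in C.
  by rewrite mem_cat; apply/orP; right; apply/mapP; exists i; rewrite ?mem_enum.
apply: (@cut_points_is_iet _ _ C) => x y xy cuts.
have ex := circle_ptK x; have ey := circle_ptK y.
have /circle_of_itv/andP[x0 x1] := erefl (circle_of x).
have yx : circle_of y = circle_of x.
  apply/circle_of_itv; rewrite (le_trans x0 xy) /= ltNge; apply/negP => y1.
  by have := cuts _ (C1 (circle_of x)); rewrite x1 y1.
move: ex ey xy cuts; rewrite yx; set i := circle_of x.
set t := n%:R * _; set u := n%:R * _ => <- <-.
rewrite !hg !val_circle_pt ler_pM2r ?invr_gt0 // lerD2l => tu cuts.
have := cuts _ (C2 i).
rewrite ltr_pM2r ?invr_gt0 // ler_pM2r ?invr_gt0 // -(natr1 i) -addrA.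
rewrite ltrD2l lerD2l negb_and -leNgt -ltNge !fracD.
have [a0 a1] := (frac_ge0 (a i), frac_lt1 (a i)).
move=> cut; rewrite -!mulrBl; congr (_ / _).
by case: ltP => h; case: ltP => h'; case/orP: cut => h''; lra.
Qed.

Lemma acts_by_Gn g s a : acts_by g s a -> Gn R n g.
Proof.
move=> hg; split; first exact: acts_by_is_iet hg.
by exists s; exact: acts_by_associated_perm hg.
Qed.

Lemma Gn_acts_by g : Gn R n g -> exists s a, acts_by g s a.
Proof. by move=> [_ [s [a /rotation_data_acts_by ha]]]; exists s; eexists; exact: ha. Qed.

Lemma acts_by1 : acts_by 1%g 1%g (fun=> 0).
Proof. by move=> i t /=; rewrite perm1 addr0. Qed.

Lemma acts_byM g h s r a c : acts_by g s a -> acts_by h r c ->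
  acts_by (g * h)%g (r * s)%g (fun i => c i + a (r i)).
Proof. by move=> hg hh i t /=; rewrite hh hg permM addrA. Qed.

Lemma acts_byX g s a k : acts_by g s a ->
  acts_by (g ^+ k)%g (s ^+ k)%g (fun i => \sum_(l < k) a ((s ^+ l)%g i)).
Proof.
move=> hg; elim: k => [|k IHk] i t.
  by rewrite !expg0 acts_by1 big_ord0.
by rewrite expgS expgSr big_ord_recr; exact: (acts_byM hg IHk).
Qed.

Lemma acts_by_ext g h s a c : acts_by g s a -> acts_by h s c ->
  (forall i, a i - c i \is a Num.int) -> g = h.
Proof.
move=> hg hh ac; apply: selfbijP => x; have [i [t ->]] := circle_ptP x.
by rewrite hg hh; apply: eq_circle_pt; rewrite opprD addrACA subrr add0r.
Qed.

Lemma acts_by_uniq g s r a c : acts_by g s a -> acts_by g r c ->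
  s = r /\ forall i, a i - c i \is a Num.int.
Proof.
move=> ga gc; split=> [|i].
  by apply/permP => i; have := ga i 0; rewrite gc => /circle_pt_inj[].
by have := ga i 0; rewrite gc => /esym/circle_pt_inj[_]; rewrite !add0r.
Qed.

Lemma acts_by_eq1 g s a : acts_by g s a -> g = 1%g ->
  s = 1%g /\ forall i, a i \is a Num.int.
Proof.
move=> hg g1; rewrite g1 in hg; have [-> ha] := acts_by_uniq hg acts_by1.
by split=> // i; rewrite -[a i]subr0.
Qed.

(** * Consequences of reversibility for the angles; the rotation by a third of a turn *)

Lemma reversible_finite_order f b s a r c :
  acts_by f s a -> acts_by b r c -> (b ^+ 2 = 1)%g -> (b * f * b = f^-1)%g ->
  distinct_cycle_lengths s -> finite_order f.
Proof.
move=> fa bc b2 bfb s_dist.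
have [rr cc] := acts_by_eq1 (acts_byM bc bc) b2.
have [srsr _] := acts_by_eq1 (acts_byM fa (acts_byM bc (acts_byM fa bc)))
  (reversible_eq1 bfb).
have rV : (r^-1 = r)%g by apply/eqP; rewrite eq_invg_mul rr.
have sr : (s ^ r = s^-1)%g.
  by rewrite conjgE rV; apply/eqP; rewrite eq_mulgV1 invgK mulgA srsr.
have r_orbit i : r i \in porbit s i.
  (* Both cycles have the same length, as [r] maps one onto the other. *)
  have h : porbit s (r i) = porbit s i.
    apply: s_dist; rewrite ?imset_f //.
    by rewrite porbit_reversed // card_imset //; exact: perm_inj.
  by rewrite -h porbit_id.
set N := #[s]%g; pose A i := \sum_(l < N) a ((s ^+ l)%g i).
have FA : acts_by (f ^+ N)%g 1%g A by rewrite -(expg_order s); exact: acts_byX.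
(* Since [f ^+ N] commutes with [f], the angles of the two products agree modulo 1; the common term
   [a i] cancels. *)
have A_s i : A (s i) - A i \is a Num.int.
  have F_f : acts_by (f ^+ N * f)%g (1 * s)%g (fun j => A j + a j).
    rewrite -expgSr expgS; have := acts_byM fa FA.
    by under [X in acts_by _ _ X]eq_fun do rewrite perm1.
  have [_ /(_ i)] := acts_by_uniq (acts_byM FA fa) F_f.
  by rewrite opprD [- A i - _]addrC addrACA subrr add0r.
have A_orbit i j : j \in porbit s i -> A j - A i \is a Num.int.
  case/porbitP => k ->; elim: k => [|k IHk]; first by rewrite expg0 perm1 subrr.
  by rewrite expgSr permM -[A _](subrK (A ((s ^+ k)%g i))) -addrA rpredD.
have [_ cA] := acts_by_eq1 (acts_byM FA (acts_byM bc (acts_byM FA bc)))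
  (reversible_eq1 (reversibleX N b2 bfb)).
(* At [i], [cA] says that [c i + A (r i) + c (r i) + A i] is an integer. The [c] terms drop out by
   [b ^+ 2 = 1], and [A (r i)] agrees with [A i] modulo 1. *)
have A2 i : A i + A i \is a Num.int.
  have := rpredB (rpredB (cA i) (cc i)) (A_orbit _ _ (r_orbit i)).
  rewrite !permM !perm1 -permM rr perm1.
  by rewrite (_ : _ - _ - _ = A i + A i) //; ring.
exists (N * 2)%N; first by rewrite muln_gt0 order_gt0.
rewrite expgM expg2; apply: acts_by_ext (acts_byM FA FA) _ _.
  by rewrite mulg1; exact: acts_by1.
by move=> i; rewrite subr0 perm1.
Qed.

Lemma third_turn_order3 : (circle_iet 1%g (fun=> 3^-1 : R)%R ^+ 3 = 1)%g.
Proof.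
apply: (acts_by_ext (acts_byX 3 (circle_iet_acts_by _ _))).
  rewrite expg1n; exact: acts_by1.
by move=> i; rewrite sumr_const card_ord subr0 -[_ *+ 3]mulr_natr mulVf ?rpred1 ?pnatr_eq0.
Qed.

Lemma third_turn_not_reversible :
  ~ strongly_reversible_in (Gn R n) (circle_iet 1%g (fun=> 3^-1)).
Proof.
move=> [_ [b [/Gn_acts_by[r [c bc]] b2 bfb]]].
have [rr cc] := acts_by_eq1 (acts_byM bc bc) b2.
set f := circle_iet _ _ in bfb; have fa : acts_by f _ _ := circle_iet_acts_by _ _.
have [_ /(_ ord0)] := acts_by_eq1 (acts_byM fa (acts_byM bc (acts_byM fa bc)))
  (reversible_eq1 bfb).
(* Removing the angle of [b ^+ 2] leaves two thirds of a turn, which would have to be an integer. *)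
move=> h; have := rpredB h (cc ord0).
have -> : c ord0 + 3^-1 + c ((r * 1)%g ord0) + 3^-1 - (c ord0 + c (r ord0)) = 2 / 3.
  by rewrite mulg1; field.
by rewrite intrEfloor (@floor_def _ _ 0) => [/eqP|]; lra.
Qed.

(** A dense orbit starting in circle 0 must enter the interior of circle [j], and [s] tracks which
    circle each iterate lies in. *)
Lemma orbit_dense_transitive f s a : acts_by f s a -> minimal f ->
  forall j, j \in porbit s ord0.
Proof.
(* The midpoint [y] has the open interior of circle [j] as a neighbourhood. *)
move=> fa f_min j; pose x := circle_pt ord0 0; pose y := circle_pt j 2^-1.
have y_mid : \val y = (j%:R + 2^-1) / n%:R.
  by rewrite val_circle_pt frac_small //; lra.
have y_nbhs : nbhs (\val y) `]j%:R / n%:R, j.+1%:R / n%:R[%classic.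
  rewrite y_mid; apply: open_nbhs_nbhs; split; first exact: interval_open.
  by rewrite /= in_itv /= !ltr_pM2r ?invr_gt0 // -(natr1 j); apply/andP; split; lra.
have fX k : circle_of ((f ^+ k)%g x) = (s ^+ k)%g ord0.
  by rewrite (acts_byX k fa) circle_of_pt.
(* Backward iterates are handled by moving them forward to [x] again, so angles of inverses are
   never computed. *)
have f_back k : (s ^+ k)%g (circle_of ((f ^- k)%g x)) = ord0.
  have [i [t xE]] := circle_ptP ((f ^- k)%g x).
  rewrite xE circle_of_pt -(circle_of_pt ((s ^+ k)%g i) (t + \sum_(l < k) a ((s ^+ l)%g i))).
  by rewrite -(acts_byX k fa) -xE sb_invK circle_of_pt.
have [z [[k zE]]] := f_min x (\val y) (valP y) _ y_nbhs.
rewrite /= in_itv /= => /andP[/ltW z0 z1].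
case: zE z0 z1 => -> z0 z1.
  have <- : circle_of ((f ^+ k)%g x) = j by apply/circle_of_itv; rewrite z0.
  by rewrite fX mem_porbit.
have jE : circle_of ((f ^- k)%g x) = j by apply/circle_of_itv; rewrite z0.
by rewrite porbit_sym -(f_back k) jE mem_porbit.
Qed.

End Circles.

(** * A reversible element of infinite order on two circles *)

Lemma pi_multiple_not_int (R : realType) (k : nat) : (0 < k)%N ->
  pi *+ k \is a @Num.int R -> False.
Proof.
move=> k_gt0 /intrP[z zE]; apply: (@pi_irrationnal R); apply/rationalP.
exists z, k; rewrite -zE -[pi *+ k]mulr_natr mulfK // pnatr_eq0 -lt0n //.
Qed.

Lemma reversible_infinite_order (R : realType) :
  exists f : selfbij (unit_itv R),
    strongly_reversible_in (Gn R 2) f /\ ~ finite_order f.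
Proof.
(* Here [pi] is just a convenient irrational: a full turn has length 1, so no positive multiple of
   this angle is trivial. *)
pose a (i : 'I_2) : R := if i == ord0 then pi else - pi.
pose r := tperm (ord0 : 'I_2) ord_max.
have aV i : a (r i) = - a i.
  rewrite /a; case: tpermP => [->|->|/eqP i0 /eqP i1]; rewrite ?eqxx ?opprK //.
  by case: i i0 i1 => [[|[|]]].
pose f := circle_iet 1%g a; pose b := circle_iet r (fun=> 0 : R).
have fa : acts_by f 1%g a := circle_iet_acts_by _ _.
have bc : acts_by b r (fun=> 0) := circle_iet_acts_by _ _.
exists f; split; last first.
  move=> [k k_gt0 fk].
  have [_ /(_ ord0)] := acts_by_eq1 (acts_byX k fa) fk.
  under eq_bigr do rewrite expg1n perm1.
  by rewrite sumr_const card_ord; exact: pi_multiple_not_int.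
split; first exact: acts_by_Gn fa.
exists b; split; first exact: acts_by_Gn bc.
  have bb := acts_byM bc bc; rewrite tperm2 in bb.
  by rewrite expg2; apply: (acts_by_ext bb (@acts_by1 R 1)) => i; rewrite addr0 subr0 rpred0.
apply: (mulIg f); rewrite mulVg.
have := acts_byM (acts_byM (acts_byM bc fa) bc) fa.
rewrite !mul1g tperm2 => h.
apply: (acts_by_ext h (@acts_by1 R 1)) => i.
by rewrite perm1 aV !(addr0, add0r, subr0, addrN, addNr).
Qed.

(** * Assembly of the finite-order, infinite-order and minimality claims *)

Theorem corollary1 (R : realType) :
  (forall n : nat, (0 < n)%N ->
     (forall (f : selfbij (unit_itv R)) (s : 'S_n),
        strongly_reversible_in (Gn R n) f ->
        associated_perm f s ->
        is_full_cycle s \/ distinct_cycle_lengths s ->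
        finite_order f) /\
     (exists f : selfbij (unit_itv R),
        Gn R n f /\ finite_order f /\ ~ strongly_reversible_in (Gn R n) f))
  /\
  ((exists n : nat, (0 < n)%N /\
      exists f : selfbij (unit_itv R),
        strongly_reversible_in (Gn R n) f /\ ~ finite_order f) /\
   (forall n : nat, (0 < n)%N ->
      forall f : selfbij (unit_itv R), Gn R n f ->
        ~ (minimal f /\ strongly_reversible_in (Gn R n) f))).
Proof.
split; last split.
- move=> [//|m] _; split.
    move=> f s [_ [b [/Gn_acts_by[r [c bc]] b2 bfb]]] [a /rotation_data_acts_by fa] s_cycles.
    apply: (reversible_finite_order fa bc b2 bfb).
    by case: s_cycles => // /full_cycle_distinct.
  exists (circle_iet 1%g (fun _ : 'I_m.+1 => 3^-1)); split.
    exact: acts_by_Gn (circle_iet_acts_by _ _).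
  split; first by exists 3%N => //; exact: third_turn_order3.
  exact: third_turn_not_reversible.
- by exists 2%N; split => //; exact: reversible_infinite_order.
move=> [//|m] _ f /Gn_acts_by[s [a fa]] [f_min [_ [b [/Gn_acts_by[r [c bc]] b2 bfb]]]].
apply: (finite_order_not_minimal _ f_min).
apply: (reversible_finite_order fa bc b2 bfb); apply: full_cycle_distinct.
(* Transitivity leaves a single cycle, so [s] is a full cycle. *)
have s_trans := orbit_dense_transitive fa f_min.
apply/setP => A; rewrite !inE; apply/imsetP/eqP => [[i _ ->]|->]; last first.
  by exists ord0 => //; apply/setP => i; rewrite s_trans inE.
have /eqP -> : porbit s i == porbit s ord0 by rewrite eq_porbit_mem s_trans.
by apply/setP => j; rewrite s_trans inE.
Qed.
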